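(* Let $n\ge 2$, $G=\mathbb{F}_2^n$ (additive group), $S\subset G$ with $0\notin S$, and let $\Gamma=\mathrm{Cay}(G,S)$ be a connected graph. Let $0\ne a\in G$ and $g\in G$. Let $d=|S|$ and $M=\gcd(d-\alpha_z : z\in G)$. If $\Gamma$ has PST between $g$ and $g+a$ at some time, then the minimum time $t>0$ at which $\Gamma$ has PST between $g$ and $g+a$ is $\frac{\pi}{M}$, and $M=2^\ell$ for some integer $\ell$ with $1\le\ell\le\lfloor n/2\rfloor$.
   Context: The Cayley graph $\mathrm{Cay}(G,S)$ has vertex set $G$, with $u,v$ adjacent iff $u-v\in S$; it is connected when $S$ generates $G$. Let $A$ be its adjacency matrix and $H(t)=\exp(itA)=(H_{u,v}(t))_{u,v\in G}$, $t\in\mathbb{R}$, $i=\sqrt{-1}$. $\Gamma$ has perfect state transfer (PST) between $u$ and $v$ at time $t>0$ if $|H_{u,v}(t)|=1$. For $z\in\mathbb{F}_2^n$, $\chi_z(g)=(-1)^{z\cdot g}$ with $z\cdot g=\sum_j z_jg_j\in\mathbb{F}_2$, and $\alpha_z=\sum_{g\in S}\chi_z(g)\in\mathbb{Z}$. *)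

(* Defs.v *)
From HB Require Import structures.
From mathcomp Require Import all_boot all_order all_algebra.
From mathcomp Require Import complex.
From mathcomp Require Import all_classical all_reals all_analysis.
Import Order.TTheory GRing.Theory Num.Theory.
Import numFieldNormedType.Exports.

Set Implicit Arguments.
Unset Strict Implicit.
Unset Printing Implicit Defensive.

Local Open Scope ring_scope.
Local Open Scope complex_scope.

(* R[i] carries no declared topology of its own; stating the series over a
   generic numFieldType gives it the topology of its norm z |-> `|z|, and the
   limit below is taken for the product topology on the entries. *)
Definition expmx (C : numFieldType) (N : nat) (X : 'M[C]_N) : 'M[C]_N :=
  limn (fun m : nat => \sum_(k < m) (k`!%:R)^-1 *: X ^+ k).

Definition cayley (G : finZmodType) (S : {set G}) : rel G :=
  fun u v => u - v \in S.

Definition connected_graph (T : finType) (e : rel T) : Prop :=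
  forall u v : T, connect e u v.

(* Rows and columns are indexed by T through enum_val / enum_rank. *)
Definition adjmx (C : pzRingType) (T : finType) (e : rel T) : 'M[C]_#|T| :=
  \matrix_(i, j) (e (enum_val i) (enum_val j))%:R.

Definition transfer (R : realType) (T : finType) (e : rel T) (t : R)
    (u v : T) : R[i] :=
  expmx (('i * t%:C) *: adjmx R[i] e) (enum_rank u) (enum_rank v).

Definition PST (R : realType) (T : finType) (e : rel T) (u v : T) (t : R) :
    Prop :=
  0 < t /\ `|transfer e t u v| = 1.

Definition dotF2 (n : nat) (z g : 'rV['F_2]_n) : 'F_2 :=
  \sum_(j < n) z 0 j * g 0 j.

(* The exponent is the representative in {0, 1} of an element of 'F_2. *)
Definition chi (n : nat) (z g : 'rV['F_2]_n) : int :=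
  (-1) ^+ (dotF2 z g : nat).

Definition alpha (n : nat) (S : {set 'rV['F_2]_n}) (z : 'rV['F_2]_n) : int :=
  \sum_(g in S) chi z g.

(* The nonnegative gcd of the integers #|S| - alpha S z, as a natural number. *)
Definition gcdM (n : nat) (S : {set 'rV['F_2]_n}) : nat :=
  \big[gcdn/0%N]_(z : 'rV['F_2]_n) `|(#|S|%:Z - alpha S z)%R|%N.

(* Main.v *)
(* The characters chi_z diagonalise the adjacency matrix, so with N = 2^n
   H_{u,v}(t) = N^-1 sum_z chi_z(u + v) exp(i t alpha_z).  Equality in the
   triangle inequality turns PST at time t into exp(i t (d - alpha_z)) = chi_z(a)
   for all z.  As M is the gcd of the d - alpha_z and chi_z(a) = -1 for some z,
   this forces exp(i t M) = -1, hence t >= pi / M, together with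
   chi_z(a) = (-1)^((d - alpha_z) / M); the latter condition gives PST at pi / M.
   Fourier inversion at a point of S shows M | N, and M is even because every
   d - alpha_z is.  For the upper bound on M choose b with chi_b(a) = -1: then
   alpha_z - alpha_{z+b} is an odd multiple of M, so
   M^2 <= 2 (alpha_z^2 + alpha_{z+b}^2).  Summing over z outside {0, b} and
   using Parseval, sum_z alpha_z^2 = N d, one gets
   (N - 2) M^2 <= 4 (N d - d^2) <= N^2, which excludes M^2 >= 2 N. *)
Require Import Defs.
From mathcomp Require Import all_boot all_order all_algebra.
From mathcomp Require Import complex.
From mathcomp Require Import all_classical all_reals all_analysis.
From mathcomp Require Import zify ring lra.
Import Order.TTheory GRing.Theory Num.Theory.
Import numFieldNormedType.Exports.

Local Open Scope ring_scope.

(** * Entrywise matrix exponential and the circle map [expi] *)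

Section MatrixExponential.
Local Open Scope classical_set_scope.

(** Matrix balls are entrywise and the entries finitely many, so entrywise limits suffice. *)
Lemma expmx_cvgE {C : numFieldType} {N : nat} (X L : 'M[C]_N) :
  (forall i j, (fun m => \sum_(k < m) (k`!%:R)^-1 * (X ^+ k) i j) @ \oo
     --> L i j) -> expmx X = L.
Proof.
move=> cvL; apply: (@cvg_lim 'M[C]_N); first exact: norm_hausdorff.
apply/cvg_ballP => e e0; near=> m; split=> // i j.
rewrite summxE; under eq_bigr do rewrite mxE.
move: i j; near: m.
apply: filter_forall => i; apply: filter_forall => j.
exact: (cvg_ball (cvL i j)).
Unshelve. all: by end_near. Qed.

(** The series is summed eigenvalue by eigenvalue, with no diagonalising matrix. *)
Lemma expmx_spectral {C : numFieldType} {N : nat} (X : 'M[C]_N) (I : finType)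
    (c : 'I_N -> 'I_N -> I -> C) (x y : I -> C) :
    (forall k i j, (X ^+ k) i j = \sum_z c i j z * x z ^+ k) ->
    (forall z, (fun m => \sum_(k < m) (k`!%:R)^-1 * x z ^+ k) @ \oo
       --> y z) ->
  forall i j, expmx X i j = \sum_z c i j z * y z.
Proof.
move=> hX hx i j.
rewrite (expmx_cvgE X (\matrix_(i, j) \sum_z c i j z * y z)) ?mxE //.
move=> {}i {}j; rewrite mxE.
rewrite (_ : (fun m => _) = fun m => \sum_z c i j z *
    \sum_(k < m) (k`!%:R)^-1 * x z ^+ k); last first.
  apply/funext => m; under eq_bigr do rewrite hX mulr_sumr.
  rewrite exchange_big; apply: eq_bigr => z _; rewrite mulr_sumr.
  by apply: eq_bigr => k _; rewrite mulrCA.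
apply: cvg_big => [|z _].
  by apply: add_continuous.
by apply: cvgMr; exact: hx.
Qed.

Local Open Scope complex_scope.

Definition expi {R : realType} (x : R) : R[i] := cos x +i* sin x.

Lemma expi_series {R : realType} (x : R) (m : nat) :
  \sum_(k < m) (k`!%:R)^-1 * ('i%R * x%:C) ^+ k =
  series (cos_coeff x) m +i* series (sin_coeff x) m :> R[i].
Proof.
elim: m => [|m IH]; first by rewrite big_ord0 /series /= !big_geq.
rewrite big_ord_recr {}IH /= !seriesEord/= !big_ord_recr /=.
have i2 : ('i%R : R[i]) ^+ 2 = -1 by exact: sqrCi.
suff -> : (m`!%:R)^-1 * ('i%R * x%:C) ^+ m =
   cos_coeff x m +i* sin_coeff x m :> R[i] by simpc.
rewrite exprMn.
have fC : (m`!%:R : R[i])^-1 = ((m`!%:R)^-1 : R)%:C by rewrite fmorphV rmorph_nat.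
(* Splitting m by parity turns the power of ['i] into a sign times 1 or ['i]. *)
rewrite fC -rmorphXn /cos_coeff /sin_coeff /= -[in 'i%R ^+ m](odd_double_half m).
rewrite exprD -mul2n exprM i2 -(rmorphN1 (real_complex R)) -rmorphXn.
rewrite -complexiE -[in m.-1](odd_double_half m).
case: (odd m) => /=; rewrite ?expr1 ?expr0 ?half_double /real_complex_def; simpc; congr (_ +i* _);
  rewrite ?(mulrC (m`!%:R)^-1) // mulrAC ?mul0r //.
Qed.

Lemma cvg_complex {R : realType} (u v : R ^nat) (a b : R) :
  u @ \oo --> a -> v @ \oo --> b ->
  (fun m => u m +i* v m : (R[i] : numFieldType)) @ \oo
    --> (a +i* b : (R[i] : numFieldType)).
Proof.
(* In the order of [R[i]], 0 < e forces e to be real; half of it goes to each component. *)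
move=> ua vb; apply/cvgrPdist_lt => -[e e'] /=; rewrite ltcE /= => /andP[/eqP -> e0].
near=> m.
rewrite (_ : a +i* b - _ = (a - u m)%:C + 'i%C * (b - v m)%:C); last first.
  by rewrite /real_complex_def; simpc.
apply: le_lt_trans (ler_normD _ _) _.
rewrite normrM -(expr1 `|'i%C|) !normc_def /= expr0n /= !addr0 add0r expr1n sqrtr1.
rewrite mul1r !sqrtr_sqr -rmorphD ltcR (splitr e) ltrD //.
  by near: m; move/cvgrPdist_lt: ua; apply; rewrite divr_gt0.
by near: m; move/cvgrPdist_lt: vb; apply; rewrite divr_gt0.
Unshelve. all: by end_near. Qed.

Lemma expi_cvg {R : realType} (x : R) :
  (fun m => \sum_(k < m) (k`!%:R)^-1 * ('i%R * x%:C) ^+ k :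
     (R[i] : numFieldType)) @ \oo --> (expi x : (R[i] : numFieldType)).
Proof.
under eq_fun do rewrite expi_series.
apply: cvg_complex.
  by rewrite cos.unlock; exact: is_cvg_series_cos_coeff.
by rewrite sin.unlock; exact: is_cvg_series_sin_coeff.
Qed.

Lemma expiD {R : realType} (x y : R) : expi (x + y) = expi x * expi y.
Proof.
by rewrite /expi cosD sinD; simpc; rewrite (addrC (cos x * sin y)).
Qed.

Lemma expi0 {R : realType} : expi (0 : R) = 1.
Proof. by rewrite /expi cos0 sin0. Qed.

Lemma expi_pi {R : realType} : expi (pi : R) = -1.
Proof. by rewrite /expi cospi sinpi; apply/eqP; rewrite eq_complex /= oppr0 !eqxx. Qed.

Lemma expiMn {R : realType} (x : R) (m : nat) : expi (x *+ m) = expi x ^+ m.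
Proof.
by elim: m => [|m IH]; rewrite ?mulr0n ?expr0 ?expi0 // mulrS exprS expiD IH.
Qed.

Lemma normr_expi {R : realType} (x : R) : `|expi x| = 1.
Proof. by rewrite normc_def /= cos2Dsin2 sqrtr1. Qed.

(** Real parts suffice: cosine is injective on [0, pi]. *)
Lemma expi_eqN1_ge_pi {R : realType} (x : R) : 0 <= x -> expi x = -1 -> pi <= x.
Proof.
move=> x0 /(congr1 (@complex.Re R)) /= cx; rewrite leNgt; apply/negP => xpi.
suff xE : x = pi by rewrite xE ltxx in xpi.
by apply: cos_inj; rewrite ?cospi ?in_itv /= ?lexx ?pi_ge0 ?x0 ?(ltW xpi).
Qed.
End MatrixExponential.

(** * Characters of F_2^n; Fourier inversion and Parseval for [alpha] *)

Section Characters.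
Context {n : nat}.
Implicit Types (S : {set 'rV['F_2]_n}) (a b g h u v z : 'rV['F_2]_n).

Lemma chi_def z g : chi z g = if dotF2 z g == 0 then 1 else -1.
Proof. by rewrite /chi; case: (dotF2 z g) => -[|[|[]]]. Qed.

Lemma dotF2C z g : dotF2 z g = dotF2 g z.
Proof. by apply: eq_bigr => j _; rewrite mulrC. Qed.

Lemma dotF2D z g h : dotF2 z (g + h) = dotF2 z g + dotF2 z h.
Proof. by rewrite /dotF2 -big_split; apply: eq_bigr => j _; rewrite mxE mulrDr. Qed.

Lemma chiC z g : chi z g = chi g z.
Proof. by rewrite /chi dotF2C. Qed.

Lemma chiD z g h : chi z (g + h) = chi z g * chi z h.
Proof.
rewrite !chi_def dotF2D.
by case: (dotF2 z g) => -[|[|[]]] // ?; case: (dotF2 z h) => -[|[|[]]].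
Qed.

Lemma chi0 z : chi z 0 = 1.
Proof. by rewrite chi_def /dotF2 big1 // => j _; rewrite mxE mulr0. Qed.

Lemma chi_sqr z g : chi z g * chi z g = 1.
Proof. by rewrite chi_def; case: eqP. Qed.

Lemma chi_eq1 z g : (chi z g == 1) = (chi z g != -1).
Proof. by rewrite chi_def; case: (dotF2 z g == 0). Qed.

Lemma rVF2_opp g : - g = g.
Proof. by apply/rowP => j; rewrite mxE; apply/val_inj; case: (g 0 j) => -[|[|[]]].
Qed.

Lemma rVF2_addr_eq0 g h : (g + h == 0) = (g == h).
Proof. by rewrite addr_eq0 rVF2_opp. Qed.

Lemma card_rVF2 : #|{: 'rV['F_2]_n}| = (2 ^ n)%N.
Proof. by rewrite card_mx card_Fp // mul1n. Qed.

Lemma chi_separates a : a != 0 -> exists b, chi b a = -1.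
Proof.
case/rV0Pn => j aj; exists (delta_mx 0 j); rewrite chi_def ifN //.
rewrite /dotF2 (bigD1 j) //= big1 ?addr0 ?mxE ?eqxx ?mul1r // => i ij.
by rewrite mxE (negPf ij) mul0r.
Qed.

(** For nonzero a, translating z by b with chi_b(a) = -1 negates the sum. *)
Lemma sum_chi a : \sum_z chi z a = if a == 0 then (2 ^ n)%:Z else 0.
Proof.
case: eqP => [->|/eqP /chi_separates [b ba]].
  by under eq_bigr do rewrite chi0; rewrite sumr_const card_rVF2 natz.
suff: \sum_z chi z a = - \sum_z chi z a by lia.
rewrite [LHS](reindex_inj (addrI b)) -sumrN; apply: eq_bigr => z _.
by rewrite chiC chiD !(chiC a) ba mulN1r.
Qed.

(** Eigenvector equation for the characters, by the substitution v = u - g. *)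
Lemma sum_cayley_chi S z u :
  \sum_v (u - v \in S)%:R * chi z v = chi z u * alpha S z.
Proof.
rewrite (reindex_inj (addrI u)) (reindex_inj oppr_inj) /alpha mulr_sumr /=.
rewrite [RHS]big_mkcond /=; apply: eq_bigr => g _.
rewrite opprD opprK addNKr chiD rVF2_opp mulrb.
by case: (g \in S); rewrite ?mul1r ?mul0r.
Qed.

Lemma alpha0 S : alpha S 0 = #|S|%:Z.
Proof.
rewrite /alpha; under eq_bigr do rewrite chiC chi0.
by rewrite sumr_const natz.
Qed.

(** Fourier inversion: [alpha S] is the transform of the indicator of S. *)
Lemma sum_alpha_chi S h : \sum_z alpha S z * chi z h = (h \in S)%:R * (2 ^ n)%:Z.
Proof.
rewrite /alpha; under eq_bigr do rewrite mulr_suml.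
rewrite exchange_big /=.
under eq_bigr => g _ do (under eq_bigr do rewrite -chiD; rewrite sum_chi rVF2_addr_eq0).
rewrite -big_mkcondr; case: (boolP (h \in S)) => hS.
  by rewrite mul1r (big_pred1 h) // => g /=; case: eqP => [->|//]; rewrite ?hS ?andbF.
by rewrite mul0r big_pred0 // => g; case: eqP => [->|//]; rewrite ?(negPf hS) ?andbF.
Qed.

(** Parseval: expanding only one factor leaves Fourier inversion at each point of S. *)
Lemma sum_alpha_sqr S : \sum_z alpha S z ^+ 2 = (2 ^ n * #|S|)%:Z.
Proof.
under eq_bigr do rewrite expr2 {2}/alpha mulr_sumr.
rewrite exchange_big /= (eq_bigr (fun=> (2 ^ n)%:Z)) => [|g gS].
  by rewrite sumr_const -mulr_natr natz -PoszM.
by rewrite sum_alpha_chi gS mul1r.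
Qed.

(** This is d - alpha_z as a natural number, usable as an exponent and visibly even. *)
Definition gap S z : nat := (#|[set g in S | chi z g == -1]|).*2.

Lemma gapE S z : (gap S z)%:Z = #|S|%:Z - alpha S z.
Proof.
rewrite /alpha (bigID (fun g => chi z g == -1)) /=.
rewrite (eq_bigr (fun=> -1)) => [|g /andP[_ /eqP//]].
rewrite [X in - (_ + X)](eq_bigr (fun=> 1)) => [|g /andP[_]]; last first.
  by rewrite -chi_eq1 => /eqP.
rewrite !sumr_const /gap -(cardsID [set g | chi z g == -1] S).
rewrite (_ : #|S :&: _| = #|[set g in S | chi z g == -1]|); last first.
  by apply: eq_card => g; rewrite !inE.
rewrite (_ : #|S :\: _| = #|[set g in S | chi z g != -1]|); last first.
  by apply: eq_card => g; rewrite !inE andbC.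
rewrite !cardsE -muln2 !natz mulNrn natz.
by rewrite PoszM PoszD; ring.
Qed.
End Characters.

(** * Spectral form of the transfer amplitude and the PST criterion *)

Section Transfer.
Context {n : nat}.
Implicit Types (S : {set 'rV['F_2]_n}) (a b g h u v z : 'rV['F_2]_n).

(** Induction on k: orthogonality of characters at k = 0, then the eigenvector equation. *)
Lemma adjmx_cayley_exp (C : numFieldType) S k (i j : 'I_#|{: 'rV['F_2]_n}|) :
  (adjmx C (cayley S) ^+ k) i j = (2 ^ n)%:R^-1 *
    \sum_z (chi z (enum_val i + enum_val j) * alpha S z ^+ k)%:~R.
Proof.
have N0 : (2 ^ n)%:R != 0 :> C by rewrite pnatr_eq0 expn_eq0.
elim: k i j => [|k IH] i j.
  under eq_bigr do rewrite expr0 mulr1.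
  rewrite expr0 -rmorph_sum /= sum_chi rVF2_addr_eq0 (inj_eq enum_val_inj) mxE.
  by case: eqP; rewrite ?mulr0 // -pmulrn mulVf.
rewrite exprS !mxE.
under eq_bigr do rewrite mxE IH mulrCA.
rewrite -mulr_sumr; congr (_ * _).
under eq_bigr do rewrite mulr_sumr.
rewrite exchange_big /=; apply: eq_bigr => z _.
rewrite [LHS](reindex _ (onW_bij _ (enum_rank_bij _))) /=.
transitivity (((\sum_v (enum_val i - v \in S)%:R * chi z v) *
    (chi z (enum_val j) * alpha S z ^+ k))%:~R : C).
  rewrite mulr_suml rmorph_sum /=; apply: eq_bigr => v _.
  rewrite enum_rankK chiD /cayley.
  by case: (_ \in S); rewrite ?mul0r // !mul1r mulrA.
by rewrite sum_cayley_chi chiD exprS; congr (_%:~R); ring.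
Qed.

Lemma exprZmx {C : numFieldType} {N : nat} (c : C) (A : 'M[C]_N) k :
  (c *: A) ^+ k = c ^+ k *: A ^+ k.
Proof.
elim: k => [|k IH]; first by rewrite !expr0 scale1r.
by rewrite !exprS IH -!mulmxE -scalemxAl -scalemxAr scalerA.
Qed.

Local Open Scope complex_scope.

Lemma transferE {R : realType} S (t : R) u v :
  transfer (cayley S) t u v = (2 ^ n)%:R^-1 *
    \sum_z (chi z (u + v))%:~R * expi (t * (alpha S z)%:~R).
Proof.
rewrite /transfer (@expmx_spectral _ _ _ _
  (fun i j z => (2 ^ n)%:R^-1 * (chi z (enum_val i + enum_val j))%:~R)
  (fun z => 'i%R * (t * (alpha S z)%:~R)%:C)
  (fun z => expi (t * (alpha S z)%:~R))).
- by rewrite !enum_rankK mulr_sumr; apply: eq_bigr => z _; rewrite mulrA.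
- move=> k i j; rewrite exprZmx mxE adjmx_cayley_exp mulrCA mulr_sumr mulr_sumr.
  apply: eq_bigr => z _; rewrite -mulrA; congr (_ * _).
  rewrite rmorphM rmorphXn /= mulrCA; congr (_ * _).
  by rewrite rmorphM rmorph_int /= mulrA -!exprMn; congr (_ ^+ _).
- by move=> z; exact: expi_cvg.
Qed.

Lemma expi_int {R : realType} (t : R) (m : int) (d : nat) :
  expi (t * d%:R) = expi (t * (d%:Z - m)%:~R) * expi (t * m%:~R).
Proof. by rewrite -expiD -mulrDr -intrD subrK. Qed.

Lemma PSTP {R : realType} S g a (t : R) :
  PST (cayley S) g (g + a) t <->
  0 < t /\ forall z, expi t ^+ gap S z = (chi z a)%:~R.
Proof.
have gapM z : expi (t * #|S|%:R) = expi t ^+ gap S z * expi (t * (alpha S z)%:~R).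
  by rewrite (expi_int _ (alpha S z)) -gapE -pmulrn -expiMn mulr_natr.
have gga z : chi z (g + (g + a)) = chi z a.
  by rewrite addrA chiD -{2}(rVF2_opp g) subrr chi0 mul1r.
have N0 : (2 ^ n)%:R != 0 :> R[i] by rewrite pnatr_eq0 expn_eq0.
rewrite /PST transferE; under eq_bigr do rewrite gga.
split=> -[t0 H]; split=> //; first move=> z.
  have nF y : `|(chi y a)%:~R * expi (t * (alpha S y)%:~R)| = 1.
    rewrite normrM normr_expi mulr1 chi_def.
    by case: (_ == _); rewrite ?normrN ?normr1.
  have : `|\sum_z (chi z a)%:~R * expi (t * (alpha S z)%:~R)| =
      \sum_z `|(chi z a)%:~R * expi (t * (alpha S z)%:~R)|.
    under [RHS]eq_bigr do rewrite nF.
    rewrite sumr_const card_rVF2; apply: (mulfI (invr_neq0 N0)).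
    by rewrite mulVf // -[RHS]H normrM normfV normr_nat.
  case/normC_sum_eq1 => [//|c _ cE].
  (* The common value of the summands is read off at z = 0, where chi is 1 and alpha is d. *)
  have := cE 0 isT; rewrite chiC chi0 mul1r alpha0 -pmulrn (gapM z) -(cE z isT).
  move/(mulIf _) => -> //.
  by rewrite -normr_eq0 normr_expi oner_neq0.
(* Conversely, all 2^n summands equal [expi (t * #|S|%:R)], so their mean has norm 1. *)
under eq_bigr do rewrite -H -gapM.
by rewrite sumr_const card_rVF2 -[expi _ *+ _]mulr_natl mulKf // normr_expi.
Qed.
End Transfer.

(** * Divisibility, parity and size of the gcd M *)

Lemma expr_gcd1 (F : fieldType) (x : F) (m k : nat) :
  x ^+ m = 1 -> x ^+ k = 1 -> x ^+ gcdn m k = 1.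
Proof.
case: (posnP m) => [->|m0] xm xk; first by rewrite gcd0n.
have [u v uv _] := egcdnP k m0.
have := congr1 (GRing.exp x) uv.
by rewrite exprD mulnC exprM xm expr1n mulnC exprM xk expr1n mul1r.
Qed.

Section GapGcd.
Context {n : nat}.
Implicit Types (S : {set 'rV['F_2]_n}) (a b g h u v z : 'rV['F_2]_n).

Lemma gcdME S : gcdM S = \big[gcdn/0%N]_z gap S z.
Proof. by apply: eq_bigr => z _; rewrite -gapE absz_nat. Qed.

Lemma gcdM_dvd_gap S z : (gcdM S %| gap S z)%N.
Proof. by rewrite gcdME; apply: biggcdn_inf. Qed.

Lemma gcdM_even S : (2 %| gcdM S)%N.
Proof. by rewrite gcdME; apply/dvdn_biggcdP => z _; rewrite dvdn2 odd_double. Qed.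

(** As h is nonzero, Fourier inversion gives sum_z (d - alpha_z) chi_z(h) = -2^n, and M divides
    every term. *)
Lemma gcdM_dvd_pow2 S h : 0 \notin S -> h \in S -> (gcdM S %| 2 ^ n)%N.
Proof.
move=> S0 hS; have h0 : h != 0 by apply: contraNneq S0 => <-.
have : (\sum_z (gap S z)%:Z * chi z h) = - (2 ^ n)%:Z.
  under eq_bigr do rewrite gapE mulrBl.
  by rewrite sumrB -mulr_sumr sum_chi (negPf h0) sum_alpha_chi hS mulr0 mul1r sub0r.
move=> E; suff : (Posz (gcdM S) %| - (2 ^ n)%:Z)%Z by rewrite dvdzE abszN.
rewrite -E; apply: rpred_sum => z _; apply: dvdz_mulr.
exact: gcdM_dvd_gap.
Qed.

Lemma expr_gcdM S (F : fieldType) (x : F) :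
  (forall z, x ^+ gap S z = 1) -> x ^+ gcdM S = 1.
Proof.
move=> x1; rewrite gcdME; elim/big_ind: _ => // m k; exact: expr_gcd1.
Qed.

(** All x^(2 (d - alpha_z)) are 1, so x^M squares to 1; some chi_b(a) = -1 excludes x^M = 1. *)
Lemma gap_quotient_parity S a (F : fieldType) (x : F) :
    a != 0 -> (1 != -1 :> F) -> (forall z, x ^+ gap S z = (chi z a)%:~R) ->
  x ^+ gcdM S = -1 /\ forall z, chi z a = (-1) ^+ (gap S z %/ gcdM S).
Proof.
move=> a0 F2 xz.
have gapM z : x ^+ gap S z = (x ^+ gcdM S) ^+ (gap S z %/ gcdM S).
  by rewrite -exprM mulnC divnK // gcdM_dvd_gap.
have /eqP : (x ^+ gcdM S) ^+ 2 = 1.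
  rewrite exprAC; apply: expr_gcdM => z.
  by rewrite exprAC xz expr2 -intrM chi_sqr.
have [b ba] := chi_separates _ a0.
rewrite sqrf_eq1 => /orP[] /eqP xM.
  by move: (gapM b); rewrite xz xM expr1n ba => /esym/eqP; rewrite (negPf F2).
split=> // z; have := gapM z; rewrite xz xM chi_def -(signr_odd F) -(signr_odd int).
case: (odd _); case: (_ == _); rewrite ?expr0 ?expr1 // => /eqP.
  by rewrite (negPf F2).
by rewrite eq_sym (negPf F2).
Qed.

Lemma gcdM_sqr_bound S a b :
  (forall z, chi z a = (-1) ^+ (gap S z %/ gcdM S)) -> chi b a = -1 ->
  ((2 ^ n - 2) * gcdM S ^ 2 <= 2 ^ n * 2 ^ n)%N.
Proof.
move=> par ba.
set M := gcdM S in par *.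
(* With p, q the values of alpha at z and z + b, 2 (p^2 + q^2) = (p - q)^2 + (p + q)^2, and p - q is
   an odd multiple of M. *)
pose F z : int := 2 * (alpha S z ^+ 2 + alpha S (z + b) ^+ 2) - M%:Z ^+ 2.
have F_ge0 z : 0 <= F z.
  have Ez y : alpha S y = #|S|%:Z - ((gap S y %/ M) * M)%:Z.
    by rewrite divnK ?gcdM_dvd_gap // gapE opprB addrC subrK.
  have : odd (gap S z %/ M) != odd (gap S (z + b) %/ M).
    have := par (z + b); rewrite chiC chiD !(chiC a) ba par.
    by rewrite -(signr_odd int (_ z %/ _)) -(signr_odd int (_ (z + b) %/ _)); case: (odd _); case: (odd _).
  rewrite /F !Ez; move: (_ %/ M)%N (_ %/ M)%N => k l kl.
  have : (k%:Z - l%:Z) ^+ 2 >= 1.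
    suff: k != l by nia.
    by apply: contraNneq kl => ->.
  rewrite !PoszM => kl1.
  have : M%:Z ^+ 2 * 1 <= M%:Z ^+ 2 * (k%:Z - l%:Z) ^+ 2.
    by rewrite ler_wpM2l // sqr_ge0.
  have := sqr_ge0 (#|S|%:Z - k%:Z * M%:Z + (#|S|%:Z - l%:Z * M%:Z)).
  nra.
have bb : b + b = 0 by apply/eqP; rewrite rVF2_addr_eq0.
have b0 : b != 0 by apply: contra_eqN ba => /eqP->; rewrite chiC chi0.
have shift : \sum_z alpha S (z + b) ^+ 2 = \sum_z alpha S z ^+ 2.
  by rewrite [RHS](reindex_inj (addIr b)).
have sumF : \sum_z F z = 4 * (2 ^ n * #|S|)%:Z - (2 ^ n)%:Z * M%:Z ^+ 2.
  rewrite sumrB -mulr_sumr big_split /= shift.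
  by rewrite sum_alpha_sqr sumr_const card_rVF2 -mulr_natl natz; ring.
(* The terms at 0 and b, split off, add up to 4 (d^2 + alpha_b^2) - 2 M^2. *)
have : 0 <= \sum_(z | (z != 0) && (z != b)) F z by apply: sumr_ge0.
have := sumF; rewrite (bigD1 0) //= (bigD1 b) //= {1 2}/F add0r bb alpha0.
move: (\sum_(z | _) _) => s sE s0.
(* The second square, (N - 2 d)^2 with N = 2^n, gives 4 N d - 4 d^2 <= N^2. *)
have := sqr_ge0 (alpha S b); have := sqr_ge0 ((2 ^ n)%:Z - 2 * #|S|%:Z).
(* If 2^n < 2, truncated subtraction makes the left side 0. *)
case: (leqP 2 (2 ^ n)) => [|N1]; last by rewrite (eqP (ltnW N1)) mul0n.
move: (2 ^ n)%N sE => N; rewrite PoszM => sE N2 h1 h2.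
rewrite -lez_nat !PoszM -subzn //. nra.
Qed.
End GapGcd.

(** * From the size bound to the exponent l, and the theorem *)

Lemma leq_half_of_sqr_bound n l :
  (2 <= n)%N -> ((2 ^ n - 2) * (2 ^ l) ^ 2 <= 2 ^ n * 2 ^ n)%N -> (l <= n./2)%N.
Proof.
move=> n2 H; rewrite leqNgt ltn_half_double; apply/negP => nl.
have : (2 * 2 ^ n <= (2 ^ l) ^ 2)%N.
  by rewrite -expnS -expnM muln2 leq_exp2l.
(* M^2 >= 2 N contradicts the bound once N >= 8. *)
case: (ltngtP n 2) n2 => // [n3 _|nE _] le2.
  have : (2 ^ 3 <= 2 ^ n)%N by rewrite leq_exp2l.
  move: (2 ^ n)%N ((2 ^ l) ^ 2)%N H le2 => N L; nia.
(* For n = 2 the bound allows M^2 = 8, but l is an integer, so l >= 2 and M^2 >= 16. *)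
move: H nl; rewrite nE => H nl.
have : (2 ^ 4 <= (2 ^ l) ^ 2)%N by rewrite -expnM leq_exp2l //; lia.
by move: ((2 ^ l) ^ 2)%N H => L /=; lia.
Qed.

Theorem theorem4p3 (R : realType) (n : nat) (S : {set 'rV['F_2]_n})
    (a g : 'rV['F_2]_n)
    (hn : (2 <= n)%N)
    (hS : 0 \notin S)
    (hconn : connected_graph (cayley S))
    (ha : a != 0)
    (hPST : exists t : R, PST (cayley S) g (g + a) t) :
  [/\ PST (cayley S) g (g + a) (pi / (gcdM S)%:R : R),
      (forall t : R, PST (cayley S) g (g + a) t -> pi / (gcdM S)%:R <= t)
    & exists l : nat, [/\ (1 <= l)%N, (l <= n./2)%N & gcdM S = (2 ^ l)%N] ].
Proof.
have C2 : 1 != -1 :> R[i] by rewrite -subr_eq0 opprK -(natrD _ 1 1) pnatr_eq0.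
have PST_par (t : R) : PST (cayley S) g (g + a) t ->
    [/\ 0 < t, expi t ^+ gcdM S = -1
      & forall z, chi z a = (-1) ^+ (gap S z %/ gcdM S)].
  by case/PSTP => t0 /(gap_quotient_parity _ _ _ _ ha C2)[].
have [t0 /PST_par[_ t0M par]] := hPST.
have M_gt0 : (0 < gcdM S)%N.
  rewrite lt0n; apply/eqP => M0.
  by move/eqP: t0M; rewrite M0 expr0 (negPf C2).
have MR_gt0 : 0 < (gcdM S)%:R :> R by rewrite ltr0n.
split.
(* At pi / M the M-th power of [expi] is -1, so each gap power is the parity sign. *)
- apply/PSTP; split=> [|z]; first by rewrite divr_gt0 ?pi_gt0.
  rewrite -(divnK (gcdM_dvd_gap S z)) mulnC exprM -expiMn -[(pi / _) *+ _]mulr_natr.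
  by rewrite divfK ?gt_eqF // expi_pi par rmorphXn rmorphN1.
- move=> t /PST_par[t_gt0 tM _]; rewrite ler_pdivrMr //.
  apply: expi_eqN1_ge_pi; first by rewrite mulr_ge0 ?ltW.
  by rewrite mulr_natr expiMn.
(* Fourier inversion needs a point of S; an empty S would make every gap, hence M, zero. *)
have [S0|[h hS']] := set_0Vmem S.
  move: M_gt0; rewrite gcdME big1 // => z _.
  by rewrite /gap S0 (_ : [set _ in _ | _] = finset.set0) ?cards0 //; apply/setP => v; rewrite !inE.
have /(dvdn_pfactor _ _ (isT : prime 2))[l _ Ml] := gcdM_dvd_pow2 S h hS hS'.
exists l; split=> //.
  by have := gcdM_even S; rewrite Ml; case: (l).
have [b ba] := chi_separates _ ha.
by apply: leq_half_of_sqr_bound => //; rewrite -Ml; exact: (gcdM_sqr_bound _ _ _ par ba).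
Qed.
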